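(* Let $\mathcal M$ be a first-order structure and let $G$ be a topological group definable in $\mathcal M$ that has a basis of open neighborhoods of $e$ consisting of definable sets (write $G$ for $G(M)$). (i) The space $S_G^\mu(M)$ is compact. There is a topological embedding $\chi\colon G\to S_G^\mu(M)$ such that the image $\chi(G)$ is dense in $S_G^\mu(M)$, and the group multiplication of $G$ extends to a continuous map from $G\times S_G^\mu(M)$ to $S_G^\mu(M)$. (ii) Assume that every type $p\in S_G(M)$ is definable. Then the action of $G$ on $S_G^\mu(M)$ is definably separable. (iii) For any compact $G$-space $C$ and $p\in C$, if the map $g\mapsto g\cdot p$ from $G$ to $C$ is definably separable then it extends uniquely to a continuous $G$-equivariant map from $S_G^\mu(M)$ to $C$.
   Context: $M$ is the universe of $\mathcal M$; ''definable'' means definable in $\mathcal M$ with parameters from $M$. All topological groups and compact spaces are assumed Hausdorff. A $G$-space is a topological space with a continuous action $G\times C\to C$. $S_G(M)$ is the space of complete types over $M$ containing $x\in G$, with the logic topology. A type $p\in S_G(M)$ is definable if for every formula $\phi(x,y)$ the set $\{a:\phi(x,a)\in p\}$ is definable with parameters from $M$. The infinitesimal type $\mu$ is the partial type over $M$ of all formulas over $M$ defining open neighborhoods of the identity $e$. For $G$-formulas $\varphi,\psi$ over $M$, $\varphi\cdot\psi$ defines $\{ab:\varphi(a),\psi(b)\}$; $\mu\cdot p=\{\varphi\cdot\psi:\mu\vdash\varphi,\ p\vdash\psi\}$. $p\sim_\mu q$ means that $\mu\cdot p$ and $\mu\cdot q$ are logically equivalent; $p_\mu$ is the $\sim_\mu$-class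 of $p$; $S_G^\mu(M)=S_G(M)/{\sim_\mu}$ with the quotient topology. $G$ acts on $S_G^\mu(M)$ by $g\cdot p_\mu=(g\cdot p)_\mu$, where $g\cdot p$ is the left translate of $p$. The embedding $\chi$ is $g\mapsto\mathrm{tp}(g/M)_\mu$, and ''extends'' in (i) and (iii) is understood after identifying $G$ with $\chi(G)$. A map $f$ from a definable set $D$ to a compact space $C$ is definably separable if for all disjoint closed $C_1,C_2\subseteq C$ the preimages $f^{-1}(C_1)$ and $f^{-1}(C_2)$ can be separated by definable subsets of $D$ (there are disjoint definable $D_1,D_2\subseteq D$ with $f^{-1}(C_i)\subseteq D_i$). An action of $G$ on a compact space $C$ is definably separable if for every $x_0\in C$ the map $g\mapsto g\cdot x_0$ from $G$ to $C$ is definably separable. *)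

(* Defs.v *)
From HB Require Import structures.
From mathcomp Require Import all_boot all_order.
From mathcomp Require Import boolp classical_sets topology.

Set Implicit Arguments.
Unset Strict Implicit.
Unset Printing Implicit Defensive.

Local Open Scope classical_set_scope.
Local Open Scope group_scope.
Local Open Scope quotient_scope.

(** * First-order logic *)

Record language := Language {
  fsym : Type; farity : fsym -> nat;
  rsym : Type; rarity : rsym -> nat }.

Record structure (L : language) := Structure {
  carrier :> Type;
  carrier_inh : inhabited carrier;
  fint : forall f : fsym L, ('I_(farity f) -> carrier) -> carrier;
  rint : forall r : rsym L, ('I_(rarity r) -> carrier) -> Prop }.

(* [term L V] and [formula L V] have their free variables in [V].  The
   quantifier binds the variable [None] of [option V]. *)
Inductive term (L : language) (V : Type) : Type :=
| Var of V
| App (f : fsym L) of ('I_(farity f) -> term L V).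

Inductive formula (L : language) (V : Type) : Type :=
| Bot
| Eq of term L V & term L V
| Rel (r : rsym L) of ('I_(rarity r) -> term L V)
| Imp of formula L V & formula L V
| All of formula L (option V).

Arguments Bot {L V}.

Definition Not L V (phi : formula L V) : formula L V := Imp phi Bot.

Definition scons (T V : Type) (a : T) (v : V -> T) (o : option V) : T :=
  if o is Some x then v x else a.

Fixpoint eval L (M : structure L) V (v : V -> M) (t : term L V) : M :=
  match t with
  | Var x => v x
  | App f ts => fint (fun i => eval v (ts i))
  end.

Fixpoint sat L (M : structure L) V (v : V -> M) (phi : formula L V) : Prop :=
  match phi with
  | Bot => False
  | Eq t u => eval v t = eval v u
  | Rel r ts => rint (fun i => eval v (ts i))
  | Imp phi psi => sat v phi -> sat v psi
  | All phi => forall a : M, sat (scons a v) phi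
  end.

Fixpoint trename L V W (f : V -> W) (t : term L V) : term L W :=
  match t with
  | Var x => Var L (f x)
  | App g ts => App (fun i => trename f (ts i))
  end.

Fixpoint rename L V W (f : V -> W) (phi : formula L V) : formula L W :=
  match phi with
  | Bot => Bot
  | Eq t u => Eq (trename f t) (trename f u)
  | Rel r ts => Rel (fun i => trename f (ts i))
  | Imp phi psi => Imp (rename f phi) (rename f psi)
  | All phi => All (rename (omap f) phi)
  end.

Definition join (V W T : Type) (x : V -> T) (y : W -> T) (z : V + W) : T :=
  match z with inl i => x i | inr j => y j end.

(* A formula over M in the variables [V]: the "variables" [inr a] are the
   constants naming the elements a of M. *)
Definition mformula L (M : structure L) (V : Type) := formula L (V + M).

Section Definability.
Context {L : language} {M : structure L}.

Definition holds V (phi : mformula M V) (x : V -> M) : Prop :=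
  sat (join x (fun a : M => a)) phi.

Definition defset V (phi : mformula M V) : set (V -> M) :=
  [set x | holds phi x].

Definition definable V (X : set (V -> M)) : Prop :=
  exists phi : mformula M V, X = defset phi.

(* phi(x, a), for an L-formula phi(x, y) and a tuple a from M *)
Definition instance V W (phi : formula L (V + W)) (a : W -> M) :
    mformula M V :=
  rename (fun z => match z with inl i => inl i | inr j => inr (a j) end) phi.

(* Sigma |- phi modulo the elementary diagram of M *)
Definition entails V (Sigma : set (mformula M V)) (phi : mformula M V) :=
  exists k (s : 'I_k -> mformula M V),
    (forall i, Sigma (s i)) /\
    (forall x, (forall i, holds (s i) x) -> holds phi x).

Definition logically_equivalent V (Sigma Pi : set (mformula M V)) :=
  (forall phi, Pi phi -> entails Sigma phi) /\
  (forall phi, Sigma phi -> entails Pi phi).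

Definition finitely_satisfiable V (Sigma : set (mformula M V)) :=
  forall k (s : 'I_k -> mformula M V), (forall i, Sigma (s i)) ->
    exists x, forall i, holds (s i) x.

Definition complete_type V (p : set (mformula M V)) :=
  finitely_satisfiable p /\ forall phi, p phi \/ p (Not phi).

Definition definable_type n (p : set (mformula M 'I_n)) :=
  forall m (phi : formula L ('I_n + 'I_m)),
    definable [set a : 'I_m -> M | p (instance phi a)].

End Definability.

HB.instance Definition _ L (M : structure L) V := gen_eqMixin (mformula M V).
HB.instance Definition _ L (M : structure L) V :=
  gen_choiceMixin (mformula M V).
HB.instance Definition _ L (M : structure L) V :=
  isPointed.Build (mformula M V) Bot.

(** * Topological groups *)

HB.mixin Record isTopologicalGroup G of Group G & Topological G := {
  mulg_continuous : continuous (fun x : G * G => x.1 * x.2);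
  invg_continuous : continuous (fun x : G => x^-1) }.

#[short(type="topGroupType")]
HB.structure Definition TopologicalGroup :=
  {G of Group G & Topological G & isTopologicalGroup G}.

Definition topological_embedding (X Y : topologicalType) (f : X -> Y) : Prop :=
  [/\ injective f, continuous f &
      forall U : set X, open U -> exists2 V : set Y, open V & f @^-1` V = U].

Record is_gspace (G : topGroupType) (C : topologicalType) (act : G -> C -> C) :
    Prop := {
  gspace1 : forall c, act 1 c = c;
  gspaceM : forall g h c, act (g * h) c = act g (act h c);
  gspace_continuous : continuous (fun x : G * C => act x.1 x.2) }.

(** * Definable groups *)

(* G is identified, through the injection [coord], with the subset of M^n
   defined by [gdom]. *)
Record definable_group L (M : structure L) (n : nat) (G : groupType) :=
    DefinableGroup {
  gdom : mformula M 'I_n;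
  coord : G -> 'I_n -> M;
  coord_inj : injective coord;
  coord_range : range coord = defset gdom;
  mul_definable : definable
    [set join (join (coord x.1) (coord x.2)) (coord (x.1 * x.2)) | x in [set: G * G]] }.

Section Logic.
Context {L : language} {M : structure L}.

Lemma eval_rename V W (f : V -> W) (v : W -> M) (t : term L V) :
  eval v (trename f t) = eval (v \o f) t.
Proof.
elim: t => //= g ts IH; congr fint.
by apply/funext => i; exact: IH.
Qed.

Lemma sat_rename V W (f : V -> W) (v : W -> M) (phi : formula L V) :
  sat v (rename f phi) <-> sat (v \o f) phi.
Proof.
elim: phi W f v => {V} [V|V t u|V r ts|V phi IH psi IH'|V phi IH] W f v //=.
- by rewrite !eval_rename.
- suff -> : (fun i => eval v (trename f (ts i))) =
            (fun i => eval (v \o f) (ts i)) by [].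
  by apply/funext => i; exact: eval_rename.
- by rewrite IH IH'.
- split=> h a; have := h a; rewrite IH;
    (suff -> : scons a v \o omap f = scons a (v \o f) by []);
    by apply/funext; case.
Qed.

Lemma ex_tuple n V (phi : formula L (V + 'I_n)) :
  exists psi : formula L V, forall v : V -> M,
    sat v psi <-> exists z, sat (join v z) phi.
Proof.
elim: n phi => [|n IH] phi.
  exists (rename (fun w : V + 'I_0 =>
    match w with inl x => x | inr i => False_rect _ (notF (ltn_ord i)) end) phi).
  move=> v; rewrite sat_rename; split=> [h|[z]].
    exists (fun i : 'I_0 => False_rect _ (notF (ltn_ord i))).
    congr (sat _ _): h; apply/funext => -[x//|i]; by case: (notF (ltn_ord i)).
  suff -> : join v z =
    v \o (fun w : V + 'I_0 =>
      match w with inl x => x | inr i => False_rect _ (notF (ltn_ord i)) end) by [].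
  by apply/funext => -[x//|i]; case: (notF (ltn_ord i)).
pose f (w : V + 'I_n.+1) : option (V + 'I_n) :=
  match w with inl x => Some (inl x)
             | inr i => omap inr (unlift ord0 i) end.
have [psi psiE] := IH (Not (All (Not (rename f phi)))).
have key v z a : scons a (join v z) \o f =
    join v (fun i => scons a z (unlift ord0 i)) :> (_ -> M).
  by apply/funext => -[x//|i]/=; case: (unlift ord0 i).
exists psi => v; rewrite psiE; split=> [[z /=]|[z hz]].
  move=> h; apply: contrapT => hn.
  apply: h => a; rewrite sat_rename key => h; apply: hn.
  by exists (fun i => scons a z (unlift ord0 i)).
exists (fun i => z (lift ord0 i)) => /= /(_ (z ord0)); rewrite sat_rename key.
apply; congr (sat _ _): hz; apply/funext => -[x//|i] /=.
by case: unliftP => [j|] ->.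
Qed.

End Logic.

Section DefinableGroup.
Context {L : language} {M : structure L} {n : nat} {G : groupType}.
Context (D : definable_group M n G).

Local Notation mform := (mformula M 'I_n).

(* the subset of G defined by a formula, and conversely *)
Definition gset (phi : mform) : set G := [set g | holds phi (coord D g)].

Definition gdefines (phi : mform) (A : set G) : Prop :=
  defset phi = coord D @` A.

Definition gdefinable (A : set G) : Prop := definable (coord D @` A).

Definition gformula (phi : mform) : Prop := defset phi `<=` range (coord D).

(** ** The type space S_G(M) *)

Record gtype := GType {
  gtype_set :> mform -> Prop;
  gtype_complete : complete_type gtype_set;
  gtype_dom : gtype_set (gdom D) }.

HB.instance Definition _ := gen_eqMixin gtype.
HB.instance Definition _ := gen_choiceMixin gtype.

Lemma gtype_eq (p q : gtype) : gtype_set p = gtype_set q -> p = q.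
Proof.
case: p q => [p cp dp] [q cq dq] /= e; move: cp dp; rewrite e => cp dp.
by congr GType; exact: Prop_irrelevance.
Qed.

Lemma gdomP x : holds (gdom D) x <-> range (coord D) x.
Proof. by rewrite (coord_range D). Qed.

Lemma finsat_cons V (S : set (mformula M V)) phi k (s : 'I_k -> mformula M V) :
  finitely_satisfiable S -> S phi -> (forall i, S (s i)) ->
  exists x, holds phi x /\ forall i, holds (s i) x.
Proof.
move=> fs Sphi Ss.
have [i|x hx] := fs _ (fun i : 'I_k.+1 => oapp s phi (unlift ord0 i)).
  by case: unliftP => [l|] _ /=.
exists x; split=> [|i]; first by have := hx ord0; case: unliftP.
have := hx (lift ord0 i); case: unliftP => [l|] /= e; last by [].
by rewrite (lift_inj e).
Qed.

Lemma gtype_mono k (s : 'I_k -> mform) (p : gtype) phi :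
  (forall i, p (s i)) ->
  (forall g, (forall i, gset (s i) g) -> gset phi g) -> p phi.
Proof.
move=> ps h; case: (gtype_complete p) => fs /(_ phi)[//|pn].
have [i|x [hn hx]] := finsat_cons fs pn
    (s := fun i : 'I_k.+1 => oapp s (gdom D) (unlift ord0 i)).
  by case: unliftP => [l _|_] //=; exact: gtype_dom.
have := hx ord0; case: unliftP => //= _ /gdomP[g _ gx].
case: hn; rewrite -/(holds phi x) -gx; apply: h => i.
have := hx (lift ord0 i); case: unliftP => [l|] //= /lift_inj <-.
by rewrite /gset /= gx.
Qed.

Lemma gtype_ex k (s : 'I_k -> mform) (p : gtype) :
  (forall i, p (s i)) -> exists g, forall i, gset (s i) g.
Proof.
move=> ps; apply: contrapT => hn.
have pB : p (Not (gdom D)).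
  by apply: (gtype_mono ps) => g hg; case: hn; exists g.
have [i|x hx] := (gtype_complete p).1 2
    (fun i => if i == ord0 then gdom D else Not (gdom D)).
  by case: ifP => _ //; exact: gtype_dom.
exact: (hx ord_max) (hx ord0).
Qed.

Lemma gtype_mono1 (p : gtype) phi psi :
  p phi -> (forall g, gset phi g -> gset psi g) -> p psi.
Proof.
move=> pphi h; apply: (@gtype_mono 1 (fun=> phi)) => // g /(_ ord0); exact: h.
Qed.

(* the logic topology: the sets [phi] are closed under finite intersections,
   hence this subbase is a base *)
HB.instance Definition _ := isSubBaseTopological.Build gtype
  [set: mform] (fun phi => [set p : gtype | p phi]).

Lemma tp_subproof (g : G) : complete_type [set phi : mform | gset phi g].
Proof.
split=> [k s hs|phi]; first by exists (coord D g).
by have [h|h] := pselect (gset phi g); [left|right].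
Qed.

Lemma tp_dom (g : G) : gset (gdom D) g.
Proof. by apply/gdomP; exists g. Qed.

(* tp(g/M) *)
Definition tp (g : G) : gtype := GType (tp_subproof g) (tp_dom g).

(** ** Left translation *)

Lemma gdefinableP (A : set G) :
  gdefinable A <-> exists phi, gset phi = A.
Proof.
split=> [[phi e]|[phi <-]].
  exists phi; apply/seteqP; split=> g /=.
    move=> h; have : (coord D @` A) (coord D g) by rewrite e.
    by case=> g' ? /(coord_inj (d := D)) <-.
  by move=> Ag; have : (coord D @` A) (coord D g) by [exists g]; rewrite e.
exists (Not (Imp (gdom D) (Not phi))); apply/seteqP; split=> x /=.
  by case=> g hg <- /=; apply => //; exact: tp_dom.
move=> /= h; apply: contrapT => hn; apply: h => /gdomP[g _ gx] hx.
by apply: hn; exists g => //; rewrite /gset /= gx.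
Qed.


Lemma gdef_preimage (f : G -> G) (gam : formula L (('I_n + M) + 'I_n)) :
  (forall b z, sat (join (join (coord D b) (fun a : M => a)) z) gam <->
               z = coord D (f b)) ->
  forall phi, exists psi : mform, gset psi = f @^-1` gset phi.
Proof.
move=> gamE phi.
pose r (w : 'I_n + M) : ('I_n + M) + 'I_n :=
  match w with inl i => inr i | inr a => inl (inr a) end.
have [psi psiE] := @ex_tuple _ M n _ (Not (Imp gam (Not (rename r phi)))).
have key b z : sat (join (join (coord D b) (fun a : M => a)) z) (rename r phi)
    <-> holds phi z.
  rewrite sat_rename /holds; set v := (X in sat X _ <-> _).
  by suff -> : v = join z (fun a : M => a) by []; apply/funext => -[].
exists psi; apply/seteqP; split=> b; rewrite /gset /= [holds psi _]psiE.
  move=> [z /= h]; apply: contrapT => hn; apply: h => /gamE -> /key; exact: hn.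
move=> h; exists (coord D (f b)) => /=; apply; first exact/gamE.
exact/key.
Qed.

Lemma coord_graph a b z :
  [set join (join (coord D x.1) (coord D x.2)) (coord D (x.1 * x.2))
    | x in [set: G * G]] (join (join (coord D a) (coord D b)) z) <->
  z = coord D (a * b).
Proof.
split=> [[[a' b'] _ /= e]|->]; last by exists (a, b).
have <- : a' = a by apply: (coord_inj (d := D)); apply/funext => i;
  exact: (congr1 (@^~ (inl (inl i))) e).
have <- : b' = b by apply: (coord_inj (d := D)); apply/funext => i;
  exact: (congr1 (@^~ (inl (inr i))) e).
by apply/funext => i; rewrite -[LHS](congr1 (@^~ (inr i)) e).
Qed.

Lemma gdef_mulr (g : G) phi : exists psi : mform,
  gset psi = [set b | gset phi (b * g)].
Proof.
have [gam gamE] := mul_definable D.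
pose r (w : ('I_n + 'I_n + 'I_n) + M) : ('I_n + M) + 'I_n :=
  match w with
  | inl (inl (inl i)) => inl (inl i)
  | inl (inl (inr i)) => inl (inr (coord D g i))
  | inl (inr i) => inr i
  | inr a => inl (inr a)
  end.
apply: (@gdef_preimage (fun b => b * g) (rename r gam)) => b z.
rewrite -coord_graph gamE sat_rename /defset /= /holds.
set v := (X in sat X _ <-> _); set w := (X in _ <-> sat X _).
by suff -> : v = w by []; apply/funext => -[[[]|]|].
Qed.

Lemma gdef_mull (g : G) phi : exists psi : mform,
  gset psi = [set b | gset phi (g * b)].
Proof.
have [gam gamE] := mul_definable D.
pose r (w : ('I_n + 'I_n + 'I_n) + M) : ('I_n + M) + 'I_n :=
  match w with
  | inl (inl (inl i)) => inl (inr (coord D g i))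
  | inl (inl (inr i)) => inl (inl i)
  | inl (inr i) => inr i
  | inr a => inl (inr a)
  end.
apply: (@gdef_preimage (fun b => g * b) (rename r gam)) => b z.
rewrite -coord_graph gamE sat_rename /defset /= /holds.
set v := (X in sat X _ <-> _); set w := (X in _ <-> sat X _).
by suff -> : v = w by []; apply/funext => -[[[]|]|].
Qed.

(* phi(x) belongs to g.p iff phi(g x) belongs to p *)
Definition translate_set (g : G) (p : gtype) : set mform :=
  [set phi | exists2 psi, p psi & gset psi = [set b | gset phi (g * b)]].

Lemma translate_complete g p : complete_type (translate_set g p).
Proof.
split=> [k s /(_ _)/cid2-h|phi].
  have [b hb] := gtype_ex (fun i => s2valP (h i)).
  exists (coord D (g * b)) => i; have := hb i.
  by rewrite (s2valP' (h i)).
have [psi e] := gdef_mull g phi.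
have [h|h] := (gtype_complete p).2 psi; first by left; exists psi.
have eb b : gset psi b <-> gset phi (g * b) by rewrite e.
by right; exists (Not psi) => //; apply/seteqP; split=> b /= hn /eb/hn.
Qed.

Lemma translate_dom g p : translate_set g p (gdom D).
Proof.
exists (gdom D); first exact: gtype_dom.
by apply/seteqP; split=> b _ /=; exact: tp_dom.
Qed.

Definition translate (g : G) (p : gtype) : gtype :=
  GType (translate_complete g p) (translate_dom g p).

Lemma translateE g (p : gtype) phi psi :
  gset psi = [set b | gset phi (g * b)] -> translate g p phi <-> p psi.
Proof.
move=> e; split=> [[psi' h e']|h]; last by exists psi.
by apply: gtype_mono1 h _ => b; rewrite e' e.
Qed.

Lemma translateK g p : translate g^-1 (translate g p) = p.
Proof.
apply: gtype_eq; apply/funext => phi; apply/propext.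
have [psi e] := gdef_mull g^-1 phi.
apply: (iff_trans (translateE _ e)); apply: translateE.
have eb b : gset psi b <-> gset phi (g^-1 * b) by rewrite e.
apply/seteqP; split=> b /=; rewrite eb mulgA mulVg mul1g //.
Qed.

Lemma entails_gtype (p : gtype) phi : entails p phi <-> p phi.
Proof.
split=> [[k [s [ps h]]]|h]; first by apply: (gtype_mono ps) => g /h.
by exists 1%N, (fun=> phi); split=> // x /(_ ord0).
Qed.

Lemma gformula_of phi : exists psi, gformula psi /\ gset psi = gset phi.
Proof.
have : gdefinable (gset phi) by apply/gdefinableP; exists phi.
move=> [psi e]; exists psi; split; first by rewrite /gformula -e => _ [g _ <-]; exists g.
apply/seteqP; split=> g h.
  have : (coord D @` gset phi) (coord D g) by rewrite e.
  by case=> g' ? /(coord_inj (d := D)) <-.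
suff : defset psi (coord D g) by [].
by rewrite -e; exists g.
Qed.

Lemma gdefines_gset phi A : gdefines phi A <-> gformula phi /\ gset phi = A.
Proof.
rewrite /gdefines /gformula; split=> [e|[h <-]].
  split; first by rewrite e => _ [g _ <-]; exists g.
  apply/seteqP; split=> g h.
    have : defset phi (coord D g) by [].
    by rewrite e => -[g' ? /(coord_inj (d := D)) <-].
  suff : defset phi (coord D g) by [].
  by rewrite e; exists g.
apply/seteqP; split=> [x hx|_ [g hg <-]//].
by have [g _ gx] := h x hx; exists g => //; rewrite /gset /= gx.
Qed.

End DefinableGroup.

(** ** mu-types *)

Section MuTypes.
Context {L : language} {M : structure L} {n : nat} {G : topGroupType}.
Context (D : definable_group M n G).

Local Notation mform := (mformula M 'I_n).
Local Notation gtype := (gtype D).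

Definition infinitesimal : set mform :=
  [set phi | exists U : set G, [/\ open U, U 1 & gdefines D phi U]].

(* mu . p; a product phi . psi is represented by all the formulas defining
   the corresponding set *)
Definition mu_mul (p : gtype) : set mform :=
  [set theta | exists phi psi,
    [/\ gformula D phi /\ entails infinitesimal phi,
        gformula D psi /\ entails (gtype_set p) psi &
        gdefines D theta [set a * b | a in gset D phi & b in gset D psi]]].

Definition mu_equiv (p q : gtype) : Prop :=
  logically_equivalent (mu_mul p) (mu_mul q).

Lemma entails_trans V (S T : set (mformula M V)) phi :
  (forall psi, T psi -> entails S psi) -> entails T phi -> entails S phi.
Proof.
move=> ST [k [s [Ts h]]].
have st i := cid (ST _ (Ts i)).
pose k' i := projT1 (st i).
have st' i := cid (projT2 (st i)).
exists #|{: {i : 'I_k & 'I_(k' i)}}|.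
exists (fun j => projT1 (st' (tag (enum_val j))) (tagged (enum_val j))).
split=> [j|x hx]; first by case: (projT2 (st' (tag (enum_val j)))).
apply: h => i; case: (projT2 (st' i)) => _; apply=> l.
have := hx (enum_rank (Tagged (fun i => 'I_(k' i)) l)).
by rewrite enum_rankK.
Qed.

Lemma mu_equiv_refl p : mu_equiv p p.
Proof.
have h phi : mu_mul p phi -> entails (mu_mul p) phi.
  by move=> hp; exists 1%N, (fun=> phi); split=> // x /(_ ord0).
by split.
Qed.

Lemma mu_equiv_sym p q : mu_equiv p q -> mu_equiv q p.
Proof. by case. Qed.

Lemma mu_equiv_trans q p r : mu_equiv p q -> mu_equiv q r -> mu_equiv p r.
Proof.
move=> [pq qp] [qr rq]; split=> phi h.
  by apply: entails_trans pq _; exact: qr.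
by apply: entails_trans rq _; exact: qp.
Qed.

Definition mu_rel (p q : gtype) : bool := `[< mu_equiv p q >].

Lemma mu_rel_equiv : equiv_class_of mu_rel.
Proof.
split=> [p|p q|q p r]; first exact/asboolP/mu_equiv_refl.
  by apply/asboolP/asboolP => /mu_equiv_sym.
by move=> /asboolP pq /asboolP qr; apply/asboolP; exact: mu_equiv_trans pq qr.
Qed.

Canonical mu_equiv_rel := EquivRelPack mu_rel_equiv.

(* the space S_G^mu(M) *)
Definition mu_space := quotient_topology {eq_quot mu_equiv_rel}.

HB.instance Definition _ := Topological.on mu_space.

(* p |-> p_mu *)
Definition mu_class (p : gtype) : mu_space := \pi_mu_space p.

Lemma mu_classP p q : mu_class p = mu_class q <-> mu_equiv p q.
Proof. by split=> [/eqquotP/asboolP//|h]; apply/eqquotP/asboolP. Qed.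

Lemma infinitesimal_conj (g : G) phi psi :
  entails infinitesimal phi ->
  gset D psi = [set a | gset D phi (g * a * g^-1)] ->
  entails infinitesimal psi.
Proof.
move=> [k [s [mus h]]] psiE.
have ex i : exists t, infinitesimal t /\
    gset D t = [set a | gset D (s i) (g * a * g^-1)].
  have [U [oU U1 /gdefines_gset[_ UE]]] := mus i.
  have [t' t'E] := gdef_mulr D g^-1 (s i).
  have [t'' t''E] := gdef_mull D g t'.
  have [t [gt tE]] := gformula_of D t''.
  have tU : gset D t = [set a | U (g * a * g^-1)].
    by rewrite tE t''E t'E UE.
  exists t; split; last by rewrite tU UE.
  exists (gset D t); split; last exact/gdefines_gset.
    rewrite tU; move: oU; apply: open_comp => a _.
    apply: (continuous_comp (f := fun a => (g * a, g^-1))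
      (g := fun x : G * G => x.1 * x.2)); last exact: mulg_continuous.
    apply: cvg_pair; last exact: cvg_cst.
    apply: (continuous_comp (f := fun a => (g, a))
      (g := fun x : G * G => x.1 * x.2)); last exact: mulg_continuous.
    by apply: cvg_pair; [exact: cvg_cst | exact: cvg_id].
  by rewrite tU /= mulg1 mulgV.
have [t tP] := choice ex.
have [d [gd dE]] := gformula_of D (gdom D).
have mud : infinitesimal d.
  exists setT; split=> //; first exact: openT.
  apply/gdefines_gset; split=> //; rewrite dE.
  by apply/seteqP; split=> // a _; exact: tp_dom.
exists k.+1, (fun i => oapp t d (unlift ord0 i)); split.
  by move=> i; case: unliftP => [j|] _ //=; case: (tP j).
move=> x hx.
have /gd[a _ ax] : holds d x by have := hx ord0; case: unliftP.
rewrite -ax; suff : gset D psi a by [].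
rewrite psiE; apply: h => i.
have := hx (lift ord0 i); case: unliftP => [j|] //= /lift_inj <-.
rewrite -ax => hj; have : gset D (t i) a by [].
by rewrite (tP i).2.
Qed.

Lemma mu_mul_translate (g : G) p phi psi :
  mu_mul (translate g p) phi -> gformula D psi ->
  gset D psi = [set b | gset D phi (g * b)] -> mu_mul p psi.
Proof.
move=> [al [be [[gal mal] [gbe /entails_gtype pbe] /gdefines_gset[_ phiE]]]] gpsi psiE.
have [al1 al1E] := gdef_mulr D g^-1 al.
have [al2 al2E] := gdef_mull D g al1.
have [al' [gal' al'E]] := gformula_of D al2.
have [be1 be1E] := gdef_mull D g be.
have [be' [gbe' be'E]] := gformula_of D be1.
have alP a : gset D al' a <-> gset D al (g * a * g^-1).
  by rewrite al'E al2E al1E.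
have beP b : gset D be' b <-> gset D be (g * b) by rewrite be'E be1E.
exists al', be'; split; first split=> //.
- by apply: infinitesimal_conj mal _; rewrite al'E al2E al1E.
- split=> //; apply/entails_gtype; apply: (translateE p _).1 pbe.
  by rewrite be'E be1E.
apply/gdefines_gset; split=> //; rewrite psiE phiE; apply/seteqP; split=> b /=.
  move=> [a ha [c hc e]]; exists (g^-1 * a * g).
    by apply/alP; rewrite !mulgA mulgV mul1g -mulgA mulgV mulg1.
  exists (g^-1 * c); first by apply/beP; rewrite mulgA mulgV mul1g.
  by rewrite -!mulgA (mulgA g) mulgV mul1g e mulgA mulVg mul1g.
move=> [a /alP ha [c /beP hc <-]]; exists (g * a * g^-1) => //.
by exists (g * c) => //; rewrite -!mulgA (mulgA g^-1) mulVg mul1g.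
Qed.

Lemma mu_equiv_translate g p q :
  mu_equiv p q -> mu_equiv (translate g p) (translate g q).
Proof.
suff h p' q' : mu_equiv p' q' -> forall phi, mu_mul (translate g q') phi ->
    entails (mu_mul (translate g p')) phi.
  by move=> pq; split; apply: h => //; exact: mu_equiv_sym.
move=> [pq _] phi hphi.
have [psi1 psi1E] := gdef_mull D g phi.
have [psi [gpsi psiE]] := gformula_of D psi1.
have [k [s [ps h]]] : entails (mu_mul p') psi.
  by apply: pq; apply: mu_mul_translate hphi _ _; rewrite ?psiE.
have ex i : exists t, [/\ gformula D t, mu_mul (translate g p') t &
    gset D t = [set b | gset D (s i) (g^-1 * b)]].
  have [t1 t1E] := gdef_mull D g^-1 (s i).
  have [t [gt tE]] := gformula_of D t1.
  exists t; split=> //; last by rewrite tE.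
  apply: (@mu_mul_translate g^-1 _ (s i)) => //; last by rewrite tE.
  by rewrite translateK.
have [t tP] := choice ex.
exists k, t; split=> [i|x hx]; first by case: (tP i).
have [c _ cx] : range (coord D) x.
  apply: contrapT => xG; apply: (xG); apply: gpsi; apply: h => i.
  by case: (tP i) => /(_ _ (hx i)).
have : gset D psi (g^-1 * c).
  apply: h => i; have [_ _ tE] := tP i.
  have : gset D (t i) c by rewrite /gset /= cx.
  by rewrite tE.
have psiP b : gset D psi b <-> gset D phi (g * b) by rewrite psiE psi1E.
by move/psiP; rewrite mulgA mulgV mul1g /gset /= cx.
Qed.

(* g . p_mu = (g . p)_mu, by [mu_actE] *)
Definition mu_act (g : G) (c : mu_space) : mu_space :=
  mu_class (translate g (repr c)).

Lemma mu_actE g p : mu_act g (mu_class p) = mu_class (translate g p).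
Proof.
by apply/mu_classP/mu_equiv_translate/mu_classP; rewrite /mu_class reprK.
Qed.

Definition mu_embed (g : G) : mu_space := mu_class (tp D g).

Definition definably_separable (C : topologicalType) (f : G -> C) : Prop :=
  forall C1 C2 : set C, closed C1 -> closed C2 -> C1 `&` C2 = set0 ->
    exists D1 D2 : set G, [/\ gdefinable D D1, gdefinable D D2,
      D1 `&` D2 = set0, f @^-1` C1 `<=` D1 & f @^-1` C2 `<=` D2].

Definition definably_separable_action (C : topologicalType)
    (act : G -> C -> C) : Prop :=
  forall x0 : C, definably_separable (fun g => act g x0).

End MuTypes.

(* Main.v *)
Require Import Defs.
From HB Require Import structures.
From mathcomp Require Import all_boot all_order.
From mathcomp Require Import boolp classical_sets filter topology.

Set Implicit Arguments.
Unset Strict Implicit.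
Unset Printing Implicit Defensive.

Local Open Scope classical_set_scope.
Local Open Scope group_scope.

(** To a type p in S_G(M) attach the filter on G generated by the sets V A, with
    V a neighbourhood of 1 and A in p.  Two types are mu-equivalent iff their
    filters agree, so a point c of S_G^mu(M) is a filter F_c on G; F_c for c in G
    is the neighbourhood filter, and F_(g c) = g F_c.  Distinct filters contain
    complementary sets: if W^-1 W is contained in V and p, q contain A and the
    complement of V A, then W A and W (G \ V A) are disjoint.  Hence the sets
    {c | A in F_c} form a basis of a Hausdorff topology which, by compactness of
    S_G(M), is the quotient one.  For (ii), the preimages in S_G(M) of two
    disjoint closed sets are separated by a clopen set [phi], and
    {g | phi in g.p} is definable when p is.  For (iii), definable separability
    makes g |-> g.x0 converge along every complete type, and the continuity of
    the action at (1, l) makes it converge along F_c; the limit is the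
    extension. *)

(** * Formulas depend on finitely many variables *)

Section FiniteSupport.
Context {L : language} {M : structure L}.

Lemma term_finite_support V (t : term L V) :
  exists (W : finType) (c : W -> V) (t0 : term L W),
    forall v : V -> M, Defs.eval v t = Defs.eval (v \o c) t0.
Proof.
elim: t => [x|f ts IH].
  by exists unit, (fun=> x), (Var L tt).
pose W i : finType := projT1 (cid (IH i)).
have cP i := projT2 (cid (IH i)).
pose c i : W i -> V := projT1 (cid (cP i)).
have tP i := cid (projT2 (cid (cP i))).
exists {i : 'I_(farity f) & W i}, (fun w => c (tag w) (tagged w)).
exists (App (fun i => trename (fun w => Tagged W w) (projT1 (tP i)))) => v /=.
congr fint; apply/funext => i; rewrite eval_rename; exact: (projT2 (tP i)).
Qed.

(** A formula over M may name any element of M, while [definable_type] speaks of L-formulas with a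
    finite tuple of parameter variables. This lemma passes from the former to the latter; it is used
    in [definable_type_translate]. *)
Lemma formula_finite_support V (v0 : V) (phi : formula L V) :
  exists (W : finType) (c : W -> V) (phi0 : formula L W),
    forall v : V -> M, sat v phi <-> sat (v \o c) phi0.
Proof.
elim: phi v0 => {V} [V|V t u|V r ts|V phi IH psi IH'|V phi IH] v0.
- by exists void, (of_void V), Bot.
- have [W [c [t0 tE]]] := term_finite_support t.
  have [W' [c' [u0 uE]]] := term_finite_support u.
  exists (W + W')%type, (join c c'), (Eq (trename inl t0) (trename inr u0)).
  by move=> v /=; rewrite tE uE !eval_rename.
- have tsP i := term_finite_support (ts i).
  pose W i : finType := projT1 (cid (tsP i)).
  have cP i := projT2 (cid (tsP i)).
  pose c i : W i -> V := projT1 (cid (cP i)).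
  have tP i := cid (projT2 (cid (cP i))).
  exists {i : 'I_(rarity r) & W i}, (fun w => c (tag w) (tagged w)).
  exists (Rel (fun i => trename (fun w => Tagged W w) (projT1 (tP i)))) => v /=.
  set a := (X in rint X); set b := (X in _ <-> rint X).
  suff -> : a = b by [].
  by apply/funext => i; rewrite /b eval_rename; exact: (projT2 (tP i)).
- have [W [c [phi0 phiE]]] := IH v0; have [W' [c' [psi0 psiE]]] := IH' v0.
  exists (W + W')%type, (join c c'), (Imp (rename inl phi0) (rename inr psi0)).
  by move=> v /=; rewrite phiE psiE !sat_rename.
- have [W [c [phi0 phiE]]] := IH None.
  (* The indices that [c] sends to [None] stand for the bound variable: the renaming below binds
     them again, so the value [v0] given to them is never read. *)
  exists W, (fun w => odflt v0 (c w)).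
  exists (All (rename (fun w => omap (fun=> w) (c w)) phi0)) => v /=.
  have key a : sat (scons a v) phi <->
      sat (scons a (v \o (fun w => odflt v0 (c w))))
        (rename (fun w => omap (fun=> w) (c w)) phi0).
    rewrite phiE sat_rename.
    set x := (X in sat X _ <-> _); set y := (X in _ <-> sat X _).
    suff -> : x = y by [].
    by apply/funext => w; rewrite /x /y /=; case e: (c w) => [z|] //=; rewrite e.
  by split=> h a; apply/key; exact: h.
Qed.

End FiniteSupport.

(** * Types as filters on G, and compactness of S_G(M) *)

Section TypeFilter.
Context {L : language} {M : structure L} {n : nat} {G : groupType}.
Context (D : definable_group M n G).

Local Notation mform := (mformula M 'I_n).

Lemma gset_Not (phi : mform) : gset D (Not phi) = ~` gset D phi.
Proof. by []. Qed.

Lemma gset_and (phi psi : mform) :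
  gset D (Not (Imp phi (Not psi))) = gset D phi `&` gset D psi.
Proof.
apply/seteqP; split=> g; rewrite /gset /holds /=; last by move=> [? ?]; apply.
move=> h; split; apply: contrapT => hn; first by apply: h => /hn.
by apply: h => _ /hn.
Qed.

Lemma gtype_and (p : gtype D) phi psi :
  p phi -> p psi -> p (Not (Imp phi (Not psi))).
Proof.
move=> pphi ppsi.
apply: (@gtype_mono _ _ _ _ D 2 (fun i => if i == ord0 then phi else psi)).
  by move=> i /=; case: ifP.
by move=> g h; rewrite gset_and; split; [exact: (h ord0)|exact: (h ord_max)].
Qed.

Lemma gtype_Not (p : gtype D) phi : p (Not phi) <-> ~ p phi.
Proof.
split=> [pn pphi|np]; last by case: ((gtype_complete p).2 phi).
have [g /(_ ord0)] := gtype_ex (s := fun _ : 'I_1 => _) (fun=> gtype_and pphi pn).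
by rewrite gset_and gset_Not => -[].
Qed.

Lemma gdef_mul (phi psi : mform) : exists theta : mform,
  gset D theta = [set a * b | a in gset D phi & b in gset D psi].
Proof.
have [gam gamE] := mul_definable D.
pose ra (w : 'I_n + M) : (('I_n + M) + 'I_n) + 'I_n :=
  match w with inl i => inl (inr i) | inr a => inl (inl (inr a)) end.
pose rb (w : 'I_n + M) : (('I_n + M) + 'I_n) + 'I_n :=
  match w with inl i => inr i | inr a => inl (inl (inr a)) end.
pose rg (w : ('I_n + 'I_n + 'I_n) + M) : (('I_n + M) + 'I_n) + 'I_n :=
  match w with
  | inl (inl (inl i)) => inl (inr i)
  | inl (inl (inr i)) => inr i
  | inl (inr i) => inl (inl (inl i))
  | inr a => inl (inl (inr a))
  end.
(* The formula in c reads: there are a and b with phi(a), psi(b) and (a, b, c) on the graph of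
   multiplication. [t1] quantifies b away, then [t2] quantifies a. *)
have [t1 t1E] := @ex_tuple _ M n _
  (Not (Imp (rename ra phi) (Imp (rename rb psi) (Not (rename rg gam))))).
have [t2 t2E] := @ex_tuple _ M n _ t1.
have ka c a b : sat (join (join (join c (fun m : M => m)) a) b) (rename ra phi)
    <-> holds phi a.
  rewrite sat_rename /holds; set v := (X in sat X _ <-> _).
  by suff -> : v = join a (fun m : M => m) by []; apply/funext => -[].
have kb c a b : sat (join (join (join c (fun m : M => m)) a) b) (rename rb psi)
    <-> holds psi b.
  rewrite sat_rename /holds; set v := (X in sat X _ <-> _).
  by suff -> : v = join b (fun m : M => m) by []; apply/funext => -[].
have kg c a b :
    sat (join (join (join c (fun m : M => m)) a) b) (rename rg gam) <->
    [set join (join (coord D x.1) (coord D x.2)) (coord D (x.1 * x.2))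
      | x in [set: G * G]] (join (join a b) c).
  rewrite gamE sat_rename /defset /= /holds.
  set v := (X in sat X _ <-> _); set w := (X in _ <-> sat X _).
  by suff -> : v = w by []; apply/funext => -[[[]|]|].
exists t2; apply/seteqP; split=> g; rewrite /gset /= [holds t2 _]t2E.
  move=> [a /t1E[b /= h]].
  apply: contrapT => hn; apply: h => /ka ha /kb hb /kg [[x y] _ /= e].
  have ea : coord D x = a.
    by apply/funext => i; exact: (congr1 (@^~ (inl (inl i))) e).
  have eb : coord D y = b.
    by apply/funext => i; exact: (congr1 (@^~ (inl (inr i))) e).
  have eg : x * y = g.
    apply: (coord_inj (d := D)); apply/funext => i.
    exact: (congr1 (@^~ (inr i)) e).
  by apply: hn; exists x; [rewrite /gset /= ea|exists y => //; rewrite /gset /= eb].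
move=> [a ha [b hb <-]].
exists (coord D a); apply/t1E; exists (coord D b) => /=; apply.
- exact/ka.
- exact/kb.
- by apply/kg; exists (a, b).
Qed.

Definition type_filter (p : gtype D) : set_system G :=
  filter_from [set phi | p phi] (gset D).

Global Instance type_filter_proper p : ProperFilter (type_filter p).
Proof.
apply: filter_from_proper; last first.
  move=> phi pphi; have [g] := @gtype_ex _ _ _ _ D 1 (fun=> phi) p (fun=> pphi).
  by move=> /(_ ord0); exists g.
apply: filter_from_filter; first by exists (gdom D); exact: gtype_dom.
move=> phi psi pphi ppsi; exists (Not (Imp phi (Not psi))).
  exact: gtype_and.
by rewrite gset_and.
Qed.

Lemma type_filter_gset (p : gtype D) phi : type_filter p (gset D phi) <-> p phi.
Proof.
by split=> [[psi ppsi]|pphi]; [exact: gtype_mono1|exists phi].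
Qed.

(** Completeness of p in terms of filters: [type_filter p] behaves as an ultrafilter on definable
    sets. Definability of neighbourhoods and of separating sets enters the proof through this
    dichotomy. *)
Lemma type_filter_setVsetC (p : gtype D) (A : set G) : gdefinable D A ->
  type_filter p A \/ type_filter p (~` A).
Proof.
move=> /gdefinableP[phi <-].
have [pp|pp] := (gtype_complete p).2 phi; [left|right]; last rewrite -gset_Not;
  exact/type_filter_gset.
Qed.

Lemma type_filter_translate g p A :
  type_filter (translate g p) A <-> type_filter p [set b | A (g * b)].
Proof.
split=> [[phi pphi sA]|[phi pphi sA]].
  have [psi psiE] := gdef_mull D g phi.
  exists psi; first exact: (translateE _ psiE).1.
  by rewrite psiE => b /sA.
have [psi psiE] := gdef_mull D g^-1 phi.
exists psi; last first.
  by rewrite psiE => b /sA /=; rewrite mulgA mulgV mul1g.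
apply/(translateE _ (psi := phi)) => //.
by rewrite psiE; apply/seteqP; split=> b /=; rewrite mulgA mulVg mul1g.
Qed.

Lemma gtype_open phi : open [set p : gtype D | p phi].
Proof.
exists [set [set p : gtype D | p phi]]; last by rewrite bigcup_set1.
by move=> _ ->; exact: finI_from1.
Qed.

Lemma gtype_nbhsP (p : gtype D) (O : set (gtype D)) :
  nbhs p O <-> exists2 phi, p phi & [set q : gtype D | q phi] `<=` O.
Proof.
split=> [|[phi pphi sO]]; last first.
  by apply: (filterS sO); apply: open_nbhs_nbhs; split=> //; exact: gtype_open.
rewrite nbhsE => -[U [[/= F FI <-] [A FA Ap]] sO].
have [s _ sE] := FI _ FA.
(* Conjunction makes the basic sets around p a filter base, so the filter contains the finite
   intersection [A] of subbasic sets. *)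
have FF : Filter (filter_from [set phi | p phi]
    (fun phi => [set q : gtype D | q phi])).
  apply: filter_from_filter; first by exists (gdom D); exact: gtype_dom.
  move=> phi psi pphi ppsi; exists (Not (Imp phi (Not psi))).
    exact: gtype_and.
  move=> q /= qand; split; apply: gtype_mono1 qand _ => g;
    by rewrite gset_and => -[].
suff [phi pphi sA] : filter_from [set phi | p phi]
    (fun phi => [set q : gtype D | q phi]) A.
  by exists phi => //; apply: subset_trans sO => q /sA; exists A.
rewrite -sE; apply: filter_bigI => phi phis; exists phi => //=.
by move: Ap; rewrite -sE; exact.
Qed.

(** An ultrafilter F on the type space converges to the type of all phi whose clopen set lies in F.
    Finitely many such phi lie in a common type, hence have a common solution in G. *)
Lemma gtype_compact : compact [set: gtype D].
Proof.
rewrite compact_ultra => F FU _.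
pose S : set mform := [set phi | F [set q : gtype D | q phi]].
have cS : complete_type S.
  split=> [k s Ss|phi].
    have /filter_ex[q qs] : \forall q \near F, forall i, (q : gtype D) (s i).
      exact: filter_forall.
    by have [g hg] := gtype_ex qs; exists (coord D g).
  have [|] := in_ultra_setVsetC [set q : gtype D | q phi] FU; first by left.
  by move=> h; right; apply: filterS h => q /gtype_Not.
have dS : S (gdom D).
  by apply: (@filterE _ F) => q; exact: gtype_dom.
exists (GType cS dS); split=> // O /gtype_nbhsP[phi pphi sO].
exact: filterS sO pphi.
Qed.

End TypeFilter.

(** * Filters of mu-types *)

Section MuFilter.
Context {L : language} {M : structure L} {n : nat} {G : topGroupType}.
Context (D : definable_group M n G).

Local Notation mform := (mformula M 'I_n).

Lemma mulg_cvg (g h : G) (A : set G) : nbhs (g * h) A ->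
  exists U V, [/\ nbhs g U, nbhs h V & forall u v, U u -> V v -> A (u * v)].
Proof.
move=> /(mulg_continuous (g, h))[[U V] /= [gU hV] sUV].
by exists U, V; split=> // u v Uu Vv; exact: (sUV (u, v)).
Qed.

Lemma nbhs_mull (g x : G) A : nbhs (g * x) A -> nbhs x [set y | A (g * y)].
Proof.
move=> /mulg_cvg[U [V [gU xV UV]]]; apply: filterS xV => v.
exact: UV (nbhs_singleton gU).
Qed.

Lemma nbhs_mulr (g x : G) A : nbhs (x * g) A -> nbhs x [set y | A (y * g)].
Proof.
move=> /mulg_cvg[U [V [xU gV UV]]]; apply: filterS xU => u Uu.
exact: UV (nbhs_singleton gV).
Qed.

Lemma nbhs1_mul (U : set G) : nbhs (1 : G) U ->
  exists2 V, nbhs (1 : G) V & forall u v, V u -> V v -> U (u * v).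
Proof.
move=> U1; have : nbhs (1 * 1 : G) U by rewrite mulg1.
move=> /mulg_cvg[V [W [V1 W1 VW]]].
by exists (V `&` W); [exact: filterI|move=> u v [Vu _] [_ Wv]; exact: VW].
Qed.

Lemma nbhs1_invl_mul (U : set G) : nbhs (1 : G) U ->
  exists2 V, nbhs (1 : G) V & forall u v, V u -> V v -> U (u^-1 * v).
Proof.
move=> /nbhs1_mul[V V1 VU]; exists (V `&` (fun x => x^-1) @^-1` V).
  by apply: filterI => //; apply: invg_continuous; rewrite invg1.
by move=> u v [_ Vu] [Vv _]; exact: VU.
Qed.

(* The filter on G generated by the sets V A, for V a neighbourhood of 1 and A
   in p; its definable members are the consequences of mu . p. *)
Definition mu_filter (p : gtype D) : set_system G :=
  (fun x : G * G => x.1 * x.2) @ filter_prod (nbhs (1 : G)) (type_filter p).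

Global Instance mu_filter_proper p : ProperFilter (mu_filter p).
Proof. exact: fmap_proper_filter. Qed.

Lemma mu_filterP p (A : set G) : mu_filter p A <-> exists U B,
  [/\ nbhs (1 : G) U, type_filter p B & forall u b, U u -> B b -> A (u * b)].
Proof.
split=> [[[U B] /= [U1 pB sUB]]|[U [B [U1 pB UB]]]].
  by exists U, B; split=> // u b Uu Bb; exact: (sUB (u, b)).
by exists (U, B) => // -[u b] [/=]; exact: UB.
Qed.

Lemma mu_filter_mul p (U B : set G) : nbhs (1 : G) U -> type_filter p B ->
  mu_filter p [set u * b | u in U & b in B].
Proof.
move=> U1 pB; apply/mu_filterP; exists U, B; split=> // u b Uu Bb.
by exists u => //; exists b.
Qed.

(** With V V inside U, the set V B is again in the filter and V (V B) stays inside A. This is the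
    identity mu . (mu . p) = mu . p, and gives the room needed for joint continuity of the
    action. *)
Lemma mu_filter_idem p (A : set G) : mu_filter p A -> exists U B,
  [/\ nbhs (1 : G) U, mu_filter p B & forall u b, U u -> B b -> A (u * b)].
Proof.
move=> /mu_filterP[U [B [/nbhs1_mul[V V1 VU] pB UB]]].
exists V, [set v * b | v in V & b in B]; split=> //; first exact: mu_filter_mul.
by move=> u _ Vu [v Vv [b Bb <-]]; rewrite mulgA; apply: UB => //; exact: VU.
Qed.

(** Since g U B = (g U g^-1)(g B), it suffices that conjugation preserves the neighbourhoods of
    1. *)
Lemma mu_filter_translate g p A :
  mu_filter (translate g p) A <-> mu_filter p [set b | A (g * b)].
Proof.
split=> /mu_filterP[U [B [U1 pB UB]]]; apply/mu_filterP.
  exists (fun x => U (g * x * g^-1)), [set b | B (g * b)]; split=> //.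
  - apply: (nbhs_mull (A := fun x => U (x * g^-1))); apply: nbhs_mulr.
    by rewrite mulg1 mulgV.
  - exact/type_filter_translate.
  - by move=> u b /= /UB/[apply]; rewrite -!mulgA (mulgA g^-1) mulVg mul1g.
exists (fun x => U (g^-1 * x * g)), [set b | B (g^-1 * b)]; split=> //.
- apply: (nbhs_mull (A := fun x => U (x * g))); apply: nbhs_mulr.
  by rewrite mulg1 mulVg.
- apply/type_filter_translate; apply: filterS pB => b /=.
  by rewrite mulgA mulVg mul1g.
- move=> u b /= /UB/[apply].
  by rewrite /= !mulgA mulgV mul1g -(mulgA u) mulgV mulg1.
Qed.

Hypothesis definable_basis : forall U : set G, open U -> U 1 ->
  exists V : set G, [/\ gdefinable D V, open V, V 1 & V `<=` U].

Lemma nbhs1_definable (U : set G) : nbhs (1 : G) U ->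
  exists V, [/\ gdefinable D V, open V, V 1 & V `<=` U].
Proof.
rewrite nbhsE => -[O [oO O1] sO].
have [V [dV oV V1 sV]] := definable_basis oO O1.
by exists V; split=> //; exact: subset_trans sO.
Qed.

Lemma gdefinable_mul (A B : set G) : gdefinable D A -> gdefinable D B ->
  gdefinable D [set a * b | a in A & b in B].
Proof.
by move=> /gdefinableP[phi <-] /gdefinableP[psi <-]; apply/gdefinableP/gdef_mul.
Qed.

Lemma gdefinableC (A : set G) : gdefinable D A -> gdefinable D (~` A).
Proof.
by move=> /gdefinableP[phi <-]; apply/gdefinableP; exists (Not phi).
Qed.

Lemma type_filter_definable (p : gtype D) (A : set G) : type_filter p A ->
  exists B, [/\ gdefinable D B, type_filter p B & B `<=` A].
Proof.
move=> [phi pphi sA]; exists (gset D phi); split=> //; last by exists phi.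
by apply/gdefinableP; exists phi.
Qed.

Lemma entails_infinitesimal phi :
  entails (infinitesimal D) phi -> nbhs (1 : G) (gset D phi).
Proof.
move=> [k [s [mus h]]].
have : \forall g \near (1 : G), forall i, gset D (s i) g.
  apply: filter_forall => i; have [U [oU U1 /gdefines_gset[_ ->]]] := mus i.
  exact: open_nbhs_nbhs.
by apply: filterS => g; exact: h.
Qed.

Lemma entails_mu_mul p theta :
  entails (mu_mul p) theta -> mu_filter p (gset D theta).
Proof.
move=> [k [s [mus h]]].
have : \forall g \near mu_filter p, forall i, gset D (s i) g.
  apply: filter_forall => i.
  have [phi [psi [[_ /entails_infinitesimal m1] [_ /entails_gtype ppsi]]]] := mus i.
  move=> /gdefines_gset[_ ->].
  by apply: mu_filter_mul => //; exact/type_filter_gset.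
by apply: filterS => g; exact: h.
Qed.

(** Converse to [entails_mu_mul]: shrinking the neighbourhood of 1 to a definable one turns a
    product U B into a formula of mu . p. With [gformula], all solutions of theta lie in G, so that
    inclusions between subsets of G yield entailments over tuples of M. *)
Lemma mu_filter_mu_mul p (A : set G) : mu_filter p A ->
  exists theta, [/\ mu_mul p theta, gformula D theta & gset D theta `<=` A].
Proof.
move=> /mu_filterP[U [B [/nbhs1_definable[V [dV oV V1 sV]] [psi0 ppsi0 sB] UB]]].
move: dV => /gdefinableP[phi0 phi0E].
have [phi [gphi phiE]] := gformula_of D phi0.
have [psi [gpsi psiE]] := gformula_of D psi0.
have [theta0 theta0E] := gdef_mul D phi psi.
have [theta [gtheta thetaE]] := gformula_of D theta0.
exists theta; split=> //; last first.
  rewrite thetaE theta0E => _ [a + [b + <-]]; rewrite phiE phi0E psiE.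
  by move=> /sV ? /sB; exact: UB.
exists phi, psi; split; last by apply/gdefines_gset; rewrite thetaE.
  split=> //; exists 1%N, (fun=> phi); split=> [_|x /(_ ord0)//].
  by exists V; split=> //; apply/gdefines_gset; rewrite phiE.
by split=> //; apply/entails_gtype; apply: gtype_mono1 ppsi0 _; rewrite psiE.
Qed.

Lemma mu_equivP p q : mu_equiv p q <-> mu_filter p = mu_filter q.
Proof.
split=> [[pq qp]|pq].
  apply/seteqP; split=> A /mu_filter_mu_mul[theta [mtheta _ sA]];
    apply: (filterS sA); apply: entails_mu_mul; [exact: qp|exact: pq].
have h p' q' : mu_filter p' = mu_filter q' ->
    forall phi, mu_mul q' phi -> entails (mu_mul p') phi.
  move=> e phi mphi.
  have : mu_filter q' (gset D phi).
    by apply: entails_mu_mul; exists 1%N, (fun=> phi); split=> // x /(_ ord0).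
  rewrite -e => /mu_filter_mu_mul[theta [mtheta gtheta sphi]].
  exists 1%N, (fun=> theta); split=> // x /(_ ord0) hx.
  by have [g _ gx] := gtheta _ hx; rewrite -gx; apply: sphi; rewrite /gset /= gx.
by split; exact: h.
Qed.

(** The neighbourhoods are chosen with V V inside U, W definable inside V, and Z^-1 Z inside W; the
    separating set is Z C. *)
Lemma mu_filter_sep p q (A : set G) : mu_filter p A -> ~ mu_filter q A ->
  exists2 B, mu_filter p B & mu_filter q (~` B).
Proof.
move=> /mu_filterP[U [B [/nbhs1_mul[V V1 VU] /type_filter_definable]]].
move=> [C [dC pC CB] UB] nqA.
have [W [dW oW W1 WV]] := nbhs1_definable V1.
have : nbhs (1 : G) W by exact: open_nbhs_nbhs.
move=> /[dup] W1' /nbhs1_invl_mul[Z Z1 ZW].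
(* W C is definable, so q decides it. If q contained W C, then V W C, a subset of A, would be in the
   filter of q. *)
have [|qWC] := type_filter_setVsetC q (gdefinable_mul dW dC).
  move=> /(mu_filter_mul V1) qVWC; case: nqA; apply: filterS qVWC.
  move=> _ [v Vv [_ [w /WV Vw [c Cc <-]] <-]]; rewrite mulgA.
  by apply: UB; [exact: VU|exact: CB].
exists [set z * c | z in Z & c in C]; first exact: mu_filter_mul.
(* An equality z b = z' c would give b = (z^-1 z') c in W C. *)
apply: filterS (mu_filter_mul Z1 qWC) => _ [z Zz [b nb <-]] [z' Zz' [c Cc e]].
apply: nb; exists (z^-1 * z'); first exact: ZW.
by exists c => //; rewrite -mulgA e mulgA mulVg mul1g.
Qed.

Lemma mu_filter_neq_sep p q : mu_filter p <> mu_filter q ->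
  exists2 B, mu_filter p B & mu_filter q (~` B).
Proof.
move=> pq; apply: contrapT => nB; apply: pq; apply/seteqP; split=> A hA;
  apply: contrapT => nA; apply: nB; have [B hB nhB] := mu_filter_sep hA nA.
  by exists B.
by exists (~` B); rewrite ?setCK.
Qed.

(** * The topology of S_G^mu(M) and the action of G *)

Definition cfilter (c : mu_space D) : set_system G := mu_filter (repr c).

Global Instance cfilter_proper c : ProperFilter (cfilter c).
Proof. exact: mu_filter_proper. Qed.

(** Frees [cfilter] from its chosen representative, which is mu-equivalent to p. *)
Lemma cfilter_class p : cfilter (mu_class p) = mu_filter p.
Proof. by apply/mu_equivP/mu_classP; rewrite /mu_class reprK. Qed.

Lemma mu_class_ex (c : mu_space D) : exists p, c = mu_class p.
Proof. by exists (repr c); rewrite /mu_class reprK. Qed.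

Lemma cfilter_act g c A :
  cfilter (mu_act g c) A <-> cfilter c [set b | A (g * b)].
Proof. by rewrite /mu_act cfilter_class mu_filter_translate. Qed.

(** A member U B has g in B, so it contains the neighbourhood U g. Conversely, if V V g lies in A
    and W is definable inside V, then W g is in tp(g/M) and V (W g) lies in A. *)
Lemma cfilter_embed g : cfilter (mu_embed D g) = nbhs g.
Proof.
rewrite cfilter_class; apply/seteqP; split=> A.
  move=> /mu_filterP[U [B [U1 [phi /= phig sB] UB]]].
  suff : nbhs g [set x | U (x * g^-1)].
    apply: filterS => x /= Ux; rewrite -(mulg1 x) -(mulVg g) mulgA.
    by apply: UB => //; exact: sB.
  by apply: nbhs_mulr; rewrite mulgV.
move=> gA; apply/mu_filterP.
have : nbhs (1 : G) [set x | A (x * g)].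
  by apply: nbhs_mulr; rewrite mul1g.
move=> /nbhs1_mul[V V1 VA].
have [W [dW oW W1 WV]] := nbhs1_definable V1.
have [phi phiE] : exists phi, gset D phi = [set x | W (x * g^-1)].
  by move: dW => /gdefinableP[psi <-]; exact: gdef_mulr.
exists V, (gset D phi); split=> //.
- by apply/type_filter_gset; rewrite /= phiE /= mulgV.
- move=> u b Vu; rewrite phiE => /WV Vb.
  by rewrite -(mulg1 b) -(mulVg g) (mulgA b) mulgA; exact: VA.
Qed.

Lemma cfilter_inj : injective cfilter.
Proof.
move=> c d; have [p ->] := mu_class_ex c; have [q ->] := mu_class_ex d.
by rewrite !cfilter_class => e; apply/mu_classP/mu_equivP.
Qed.

Lemma cfilter_sep c d : c <> d ->
  exists2 B, cfilter c B & cfilter d (~` B).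
Proof.
by move=> cd; apply: mu_filter_neq_sep => /cfilter_inj.
Qed.

Lemma mu_class_continuous : continuous (@mu_class L M n G D).
Proof. exact: pi_continuous. Qed.

Lemma mu_space_compact : compact [set: mu_space D].
Proof.
have -> : [set: mu_space D] = @mu_class L M n G D @` setT.
  apply/seteqP; split=> // c _; have [p ->] := mu_class_ex c.
  by exists p.
apply: continuous_compact; last exact: gtype_compact.
exact/continuous_subspaceT/mu_class_continuous.
Qed.

(** Openness is tested on the preimage in S_G(M), where membership of A in the filter of p is
    witnessed by a single formula of p. *)
Lemma cfilter_open (A : set G) : open [set c | cfilter c A].
Proof.
rewrite /open /= /quotient_open openE => p.
rewrite /= -/(mu_class p) cfilter_class => /mu_filterP[U [B [U1 [phi pphi sB] UB]]].
apply/gtype_nbhsP; exists phi => // q qphi /=.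
rewrite -/(mu_class q) cfilter_class; apply/mu_filterP.
by exists U, B; split=> //; exists phi.
Qed.

Lemma mu_space_hausdorff : hausdorff_space (mu_space D).
Proof.
move=> c d cd; apply: contrapT => /cfilter_sep[B cB dB].
have [||e /= [eB enB]] := cd [set e | cfilter e B] [set e | cfilter e (~` B)].
- by apply: open_nbhs_nbhs; split=> //; exact: cfilter_open.
- by apply: open_nbhs_nbhs; split=> //; exact: cfilter_open.
by have [g []] := filter_ex (filterI eB enB).
Qed.

(** The filter generated by the basic sets around c has c as its only cluster point, by
    [cfilter_sep]; in a compact Hausdorff space it then converges to c. *)
Lemma mu_space_nbhsP (c : mu_space D) O :
  nbhs c O <-> exists2 A, cfilter c A & [set d | cfilter d A] `<=` O.
Proof.
split=> [|[A cA sO]]; last first.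
  apply: (filterS sO); apply: open_nbhs_nbhs; split=> //; exact: cfilter_open.
pose F := filter_from (cfilter c) (fun A => [set d | cfilter d A]).
have FF : ProperFilter F.
  apply: filter_from_proper; last by move=> A cA; exists c.
  apply: filter_from_filter; first by exists setT; exact: filterT.
  move=> A B cA cB; exists (A `&` B); first exact: filterI.
  by move=> d /= dAB; split; apply: filterS dAB => g [].
suff : F --> c by move=> /[apply].
apply: (compact_cluster_set1 (V := setT)) => //.
- exact: mu_space_hausdorff.
- exact: mu_space_compact.
- exact: filterT.
- exact: filterT.
apply/seteqP; split=> [d /= Fd|_ -> A O' [B cB sA] /nbhs_singleton O'c]; last first.
  by exists c; split=> //; exact: sA.
apply: contrapT => /cfilter_sep[B dB cB].
have [||e /= [eB enB]] := Fd [set e | cfilter e (~` B)] [set e | cfilter e B].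
- by exists (~` B).
- by apply: open_nbhs_nbhs; split=> //; exact: cfilter_open.
by have [g []] := filter_ex (filterI eB enB).
Qed.

(** By [cfilter_embed], the preimage of the basic open set given by A is the interior of A. *)
Lemma mu_embed_continuous : continuous (mu_embed D).
Proof.
move=> g O /mu_space_nbhsP[A + sO]; rewrite cfilter_embed => /nbhs_interior.
by apply: filterS => h Ah; apply: sO; rewrite /= cfilter_embed.
Qed.

(** If U B lies in A and b is in B, then A contains the neighbourhood U b of b, so the image of b is
    in the basic open set given by A. *)
Lemma mu_embed_dense : dense (range (mu_embed D)).
Proof.
move=> O [c Oc] oO.
have /mu_space_nbhsP[A cA sO] : nbhs c O by exact: open_nbhs_nbhs.
have := cA; have [p ->] := mu_class_ex c; rewrite cfilter_class.
move=> /mu_filterP[U [B [U1 pB UB]]]; have [b Bb] := filter_ex pB.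
exists (mu_embed D b); split; last by exists b.
apply: sO => /=; rewrite cfilter_embed.
have : nbhs b [set x | U (x * b^-1)] by apply: nbhs_mulr; rewrite mulgV.
by apply: filterS => x /UB/(_ Bb); rewrite -mulgA mulVg mulg1.
Qed.

Lemma mu_embed_embedding : hausdorff_space G ->
  topological_embedding (mu_embed D).
Proof.
move=> hG; split.
- move=> g h e; apply: hG => A B gA hB; apply: filter_ex (filterI _ hB).
  by rewrite -cfilter_embed -e cfilter_embed.
- exact: mu_embed_continuous.
- move=> U oU; exists [set c | cfilter c U]; first exact: cfilter_open.
  apply/seteqP; split=> g /=; rewrite cfilter_embed; first exact: nbhs_singleton.
  by move=> Ug; exact: open_nbhs_nbhs.
Qed.

(** For h in U g, write h x = (h g^-1)(g x): if g x ranges over B, then h x stays in U B, hence in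
    A. *)
Lemma mu_act_continuous :
  continuous (fun x : G * mu_space D => mu_act x.1 x.2).
Proof.
move=> [g c] O /= /mu_space_nbhsP[A]; have [p ->] := mu_class_ex c.
rewrite mu_actE cfilter_class => /mu_filter_idem[U [B [U1 pB UB]]] sO.
have oB : nbhs (mu_class p) [set d | cfilter d [set b | B (g * b)]].
  apply: open_nbhs_nbhs; split; first exact: cfilter_open.
  by rewrite /= -cfilter_act mu_actE cfilter_class.
have gU : nbhs g [set x | U (x * g^-1)] by apply: nbhs_mulr; rewrite mulgV.
exists ([set x | U (x * g^-1)], [set d | cfilter d [set b | B (g * b)]]) => //.
move=> [h d] /= [Uh dB]; apply: sO => /=.
apply/cfilter_act; apply: filterS dB => b /= /(UB _ _ Uh).
by rewrite -!mulgA (mulgA g^-1) mulVg mul1g.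
Qed.

Lemma translate_tp g h : translate g (tp D h) = tp D (g * h).
Proof.
apply: gtype_eq; apply/funext => phi; apply/propext.
have [psi psiE] := gdef_mull D g phi.
by rewrite (translateE _ psiE) /= psiE.
Qed.

Lemma mu_act_embed g h : mu_act g (mu_embed D h) = mu_embed D (g * h).
Proof. by rewrite /mu_embed mu_actE translate_tp. Qed.

End MuFilter.

(** * Definable separability of the action *)

Section Separation.
Context {L : language} {M : structure L} {n : nat} {G : groupType}.
Context (D : definable_group M n G).

(** If no formula separates, the sets of types in K1 containing phi, for phi true on K2, generate a
    proper filter. A cluster point q lies in K1, so some phi in q excludes K2; then [Not phi] holds
    on K2, which contradicts clustering at q. *)
Lemma gtype_closed_sep (K1 K2 : set (gtype D)) : closed K1 -> closed K2 ->
  K1 `&` K2 = set0 -> exists phi : mformula M 'I_n,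
    (forall p : gtype D, K1 p -> p phi) /\ (forall p : gtype D, K2 p -> ~ p phi).
Proof.
move=> cK1 cK2 K12; apply: contrapT => nphi.
pose F := filter_from
  [set phi | K2 `<=` [set p : gtype D | p phi]]
  (fun phi => K1 `&` [set p : gtype D | p phi]).
have FF : ProperFilter F.
  apply: filter_from_proper.
    apply: filter_from_filter.
      by exists (gdom D) => p _; exact: gtype_dom.
    move=> phi psi K2phi K2psi; exists (Not (Imp phi (Not psi))).
      by move=> p K2p; apply: gtype_and; [exact: K2phi|exact: K2psi].
    move=> p [K1p pand]; split; split=> //; apply: gtype_mono1 pand _ => g;
      by rewrite gset_and => -[].
  move=> phi K2phi; apply: contrapT => /set0P/negP; rewrite negbK => /eqP K1phi.
  apply: nphi; exists (Not phi); split=> p.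
    move=> K1p; apply/gtype_Not => pphi.
    by have : (K1 `&` [set p : gtype D | p phi]) p by []; rewrite K1phi.
  by move=> /K2phi pphi /gtype_Not.
have [q [_ Fq]] := gtype_compact FF filterT.
have K1q : K1 q.
  apply: cK1 => O Oq; have [|p [[K1p _] Op]] :=
    Fq (K1 `&` [set p : gtype D | p (gdom D)]) O _ Oq.
    by exists (gdom D) => // p _; exact: gtype_dom.
  by exists p.
have [phi qphi sphi] : exists2 phi, (q : gtype D) phi &
    [set p : gtype D | p phi] `<=` ~` K2.
  apply/gtype_nbhsP; apply: open_nbhs_nbhs; split; first exact: closed_openC.
  by move=> K2q; have : (K1 `&` K2) q by []; rewrite K12.
have [||p [[_ pn] pphi]] := Fq (K1 `&` [set p : gtype D | p (Not phi)])
    [set p : gtype D | p phi].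
- by exists (Not phi) => // p K2p; apply/gtype_Not => /sphi; exact.
- by apply/gtype_nbhsP; exists phi.
by case/gtype_Not: pn.
Qed.

Lemma definable_type_translate (p : gtype D) phi : definable_type p ->
  gdefinable D [set g | translate g p phi].
Proof.
move=> defp; have [gam gamE] := mul_definable D.
have [m0] := carrier_inh M.
pose ra (w : 'I_n + M) : ('I_n + ('I_n + M)) + 'I_n :=
  match w with inl i => inr i | inr a => inl (inr (inr a)) end.
pose rg (w : ('I_n + 'I_n + 'I_n) + M) : ('I_n + ('I_n + M)) + 'I_n :=
  match w with
  | inl (inl (inl i)) => inl (inr (inl i))
  | inl (inl (inr i)) => inl (inl i)
  | inl (inr i) => inr i
  | inr a => inl (inr (inr a))
  end.
(* [theta] expresses phi(g b), with the coordinates of g and the constants from M both treated as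
   parameter variables. *)
have [theta thetaE] := @ex_tuple _ M n _
  (Not (Imp (rename ra phi) (Not (rename rg gam)))).
have thetaP g b :
    sat (join (coord D b) (join (coord D g) (fun a : M => a))) theta <->
    gset D phi (g * b).
  have ka z : sat (join (join (coord D b) (join (coord D g) (fun a : M => a))) z)
      (rename ra phi) <-> holds phi z.
    rewrite sat_rename /holds; set v := (X in sat X _ <-> _).
    by suff -> : v = join z (fun m : M => m) by []; apply/funext => -[].
  have kg z : sat (join (join (coord D b) (join (coord D g) (fun a : M => a))) z)
      (rename rg gam) <-> z = coord D (g * b).
    rewrite -coord_graph gamE sat_rename /defset /= /holds.
    set v := (X in sat X _ <-> _); set w := (X in _ <-> sat X _).
    by suff -> : v = w by []; apply/funext => -[[[]|]|].
  rewrite thetaE; split=> [[z /= h]|h].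
    apply: contrapT => hn; apply: h => /ka hz /kg ez.
    by apply: hn; rewrite /gset /= -ez.
  by exists (coord D (g * b)) => /=; apply; [exact/ka|exact/kg].
have [W [c [theta0 theta0E]]] :=
  @formula_finite_support _ M _ (inr (inr m0)) theta.
(* Every index in W gets a parameter slot, but only those that [c] sends to a parameter use it;
   [a g] fills the idle slots with [m0]. *)
pose r (w : W) : 'I_n + 'I_#|W| :=
  match c w with inl i => inl i | inr _ => inr (enum_rank w) end.
pose a (g : G) (j : 'I_#|W|) : M :=
  match c (enum_val j) with
  | inl _ => m0 | inr (inl i) => coord D g i | inr (inr m) => m end.
have thetaI g : gset D (instance (rename r theta0) (a g)) =
    [set b | gset D phi (g * b)].
  apply/seteqP; split=> b; rewrite /gset /= -[holds phi _]thetaP theta0E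
    /holds /instance !sat_rename; set v := (X in sat X _ -> _);
    set w := (X in _ -> sat X _); suff -> : v = w by [].
    apply/funext => w'; rewrite /v /w /= /r; case e : (c w') => [i|[i|m]] //=;
      by rewrite /a enum_rankK e.
  apply/funext => w'; rewrite /v /w /= /r; case e : (c w') => [i|[i|m]] //=;
    by rewrite /a enum_rankK e.
have [del delE] := defp _ (rename r theta0).
(* Substituting [a g] for the parameters turns the formula [del] defining p into a formula in g over
   M. *)
pose rd (w : 'I_#|W| + M) : 'I_n + M :=
  match w with
  | inl j => match c (enum_val j) with
             | inl _ => inr m0 | inr (inl i) => inl i | inr (inr m) => inr m end
  | inr m => inr m
  end.
apply/gdefinableP; exists (rename rd del).
have delP g : holds (rename rd del) (coord D g) <-> holds del (a g).
  rewrite /holds sat_rename.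
  set v := (X in sat X _ <-> _); set w := (X in _ <-> sat X _).
  suff -> : v = w by [].
  apply/funext => -[j|//]; rewrite /v /w /= /a.
  by case: (c (enum_val j)) => [|[]].
apply/seteqP; split=> g.
  move=> /delP; rewrite -[holds _ _]/(defset del _) -delE => /= h.
  exact/(translateE _ (thetaI g)).
move=> /= /(translateE _ (thetaI g)) h; apply/delP.
by rewrite -[holds _ _]/(defset del _) -delE.
Qed.

End Separation.

Lemma mu_act_definably_separable (L : language) (M : structure L) (n : nat)
    (G : topGroupType) (D : definable_group M n G) :
  (forall p : gtype D, definable_type p) ->
  definably_separable_action D (@mu_act L M n G D).
Proof.
move=> defp c C1 C2 cC1 cC2 C12; have [p ->] := mu_class_ex c.
have preC (C : set (mu_space D)) : closed C ->
    closed (@mu_class L M n G D @^-1` C).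
  by move=> cC; apply: preimage_closed => // q _; exact: mu_class_continuous.
have [|phi [C1phi C2phi]] := gtype_closed_sep (preC _ cC1) (preC _ cC2).
  by rewrite -preimage_setI C12 preimage_set0.
have dphi := definable_type_translate phi (defp p).
exists [set g | translate g p phi], (~` [set g | translate g p phi]).
split=> //.
- exact: gdefinableC.
- exact: setICr.
- by move=> g /=; rewrite mu_actE; exact: C1phi.
- by move=> g /=; rewrite mu_actE; exact: C2phi.
Qed.

(** * Extension of orbit maps to S_G^mu(M) *)

Section Extension.
Context {L : language} {M : structure L} {n : nat} {G : topGroupType}.
Context (D : definable_group M n G) (C : topologicalType).
Hypotheses (C_compact : compact [set: C]) (C_hausdorff : hausdorff_space C).

(** Let l be a cluster point and N a neighbourhood of l whose closure lies in the interior of O. A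
    definable D1 separates the preimage of that closure from the preimage of the complement of the
    interior. If p contains D1, then f lands in O along p; otherwise f avoids N along p, and l is no
    cluster point. *)
Lemma definably_separable_type_cvg (f : G -> C) (p : gtype D) :
  definably_separable D f -> exists l : C, f @ type_filter p --> l.
Proof.
move=> sepf.
have [l [_ fl]] := C_compact (fmap_proper_filter f (type_filter_proper p)) filterT.
exists l => O /nbhs_interior lO.
have [N Nl sN] : filter_from (nbhs l) closure O°.
  exact: (@compact_regular _ _ setT C_hausdorff C_compact filterT).
have [|D1 [D2 [dD1 _ D12 sD1 sD2]]] := sepf (closure N) (~` O°)
    (@closed_closure _ N) (open_closedC (@open_interior _ O)).
  by rewrite -subset0 => x [/sN].
have [pD1|pD1] := type_filter_setVsetC p dD1.
  apply: filterS pD1 => g D1g; apply: (@interior_subset _ O).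
  apply: contrapT => nO; have D2g : D2 g by exact: sD2.
  by have : (D1 `&` D2) g by []; rewrite D12.
have [|x [nx Nx]] := fl (~` closure N) N _ Nl.
  by apply: filterS pD1 => g nD1 /= Nfg; apply: nD1; exact: sD1.
by case: nx; exact: subset_closure.
Qed.

Context (act : G -> C -> C) (x0 : C).
Hypotheses (act_gspace : is_gspace act)
  (act_separable : definably_separable D (fun g => act g x0)).

Lemma orbit_mu_filter_cvg (p : gtype D) :
  exists l : C, (fun g => act g x0) @ mu_filter p --> l.
Proof.
have [l fl] := definably_separable_type_cvg p act_separable.
exists l => O lO.
have [[U V] /= [U1 lV] UV] : nbhs ((1 : G), l) [set x | O (act x.1 x.2)].
  by apply: (gspace_continuous act_gspace); rewrite /= (gspace1 act_gspace).
apply/mu_filterP; exists U, [set g | V (act g x0)]; split=> //.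
  exact: fl.
by move=> u b Uu Vb /=; rewrite (gspaceM act_gspace); exact: (UV (u, act b x0)).
Qed.

Lemma act_continuous (g : G) : continuous (act g).
Proof.
move=> c O Ogc.
have [[U V] /= [Ug cV] UV] := gspace_continuous act_gspace (x := (g, c)) Ogc.
by apply: filterS cV => d Vd; apply: (UV (g, d)); split=> //; exact: nbhs_singleton.
Qed.

Lemma orbit_continuous : continuous (fun g => act g x0).
Proof.
move=> g O Ogc.
have [[U V] /= [Ug cV] UV] := gspace_continuous act_gspace (x := (g, x0)) Ogc.
by apply: filterS Ug => h Uh; apply: (UV (h, x0)); split=> //; exact: nbhs_singleton.
Qed.

Hypothesis definable_basis : forall U : set G, open U -> U 1 ->
  exists V : set G, [/\ gdefinable D V, open V, V 1 & V `<=` U].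

Lemma mu_space_extension : exists f : mu_space D -> C,
  [/\ continuous f,
      forall (g : G) (c : mu_space D), f (mu_act g c) = act g (f c) &
      forall g : G, f (mu_embed D g) = act g x0].
Proof.
have /choice[f fP] (c : mu_space D) : exists l : C,
    (fun g => act g x0) @ cfilter c --> l by exact: orbit_mu_filter_cvg.
have cvgf (c : mu_space D) l : (fun g => act g x0) @ cfilter c --> l -> f c = l.
  exact: (cvg_unique C_hausdorff (fP c)).
exists f; split.
- move=> c O /(@compact_regular _ _ setT C_hausdorff C_compact filterT)[N /fP Nc sN].
  (* If the preimage of N under the orbit map is in the filter of d, the limit [f d] lies in the
     closure of N, hence in O. *)
  apply/(mu_space_nbhsP definable_basis).
  exists [set g | N (act g x0)] => // d dN; apply: sN => A /fP Ad.
  have [g [Ng Ag]] := filter_ex (filterI dN Ad).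
  by exists (act g x0).
- move=> g c; apply: cvgf => O /act_continuous/fP gO.
  apply/(cfilter_act definable_basis g c [set h | O (act h x0)]).
  apply: (@filterS _ (cfilter c)) gO => h /=.
  by rewrite (gspaceM act_gspace).
- move=> g; apply: cvgf; rewrite (cfilter_embed definable_basis).
  exact: orbit_continuous.
Qed.

(** Any neighbourhoods A of [f c] and B of [h c] meet: the points sent into A by f and into B by h
    form a neighbourhood of c, which contains the image of some element of G. *)
Lemma mu_space_continuous_ext (f h : mu_space D -> C) :
  continuous f -> continuous h ->
  (forall g, f (mu_embed D g) = h (mu_embed D g)) -> f = h.
Proof.
move=> cf ch fh; apply/funext => c; apply: C_hausdorff => A B fA hB.
have /nbhs_interior O : nbhs c (f @^-1` A `&` h @^-1` B).
  by apply: filterI; [exact: cf|exact: ch].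
have [|d [Od [g _ gE]]] :=
    mu_embed_dense definable_basis _ (@open_interior _ (f @^-1` A `&` h @^-1` B)).
  by exists c; exact: nbhs_singleton O.
move: Od; rewrite -gE => /interior_subset[/= Af Bh].
by exists (f (mu_embed D g)); split=> //; rewrite fh.
Qed.

End Extension.

Theorem theoremA15 (L : language) (M : structure L) (n : nat)
    (G : topGroupType) (D : definable_group M n G)
    (G_hausdorff : hausdorff_space G)
    (definable_basis : forall U : set G, open U -> U 1 ->
       exists V : set G, [/\ gdefinable D V, open V, V 1 & V `<=` U]) :
  (* (i) *)
  [/\ compact [set: mu_space D],
      hausdorff_space (mu_space D),
      topological_embedding (mu_embed D),
      dense (range (mu_embed D)) &
      continuous (fun x : G * mu_space D => mu_act x.1 x.2) /\
      (forall g h : G, mu_act g (mu_embed D h) = mu_embed D (g * h))] /\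
  (* (ii) *)
  ((forall p : gtype D, definable_type p) ->
     definably_separable_action D (@mu_act L M n G D)) /\
  (* (iii) *)
  (forall (C : topologicalType) (act : G -> C -> C) (p : C),
     compact [set: C] -> hausdorff_space C -> is_gspace act ->
     definably_separable D (fun g => act g p) ->
     exists! f : mu_space D -> C,
       [/\ continuous f,
           forall (g : G) (c : mu_space D), f (mu_act g c) = act g (f c) &
           forall g : G, f (mu_embed D g) = act g p]).
Proof.
split.
  split.
  - exact: mu_space_compact.
  - exact: mu_space_hausdorff.
  - exact: mu_embed_embedding.
  - exact: mu_embed_dense.
  - by split; [exact: mu_act_continuous|exact: mu_act_embed].
split=> [|C act p cC hC gC sepC]; first exact: mu_act_definably_separable.
have [f [cf fact fp]] := mu_space_extension cC hC gC sepC definable_basis.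
exists f; split=> // h [ch _ hp].
by apply: (mu_space_continuous_ext hC definable_basis) => // g; rewrite fp hp.
Qed.
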